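(* Classically, the category $\mathbf{OA}$ of o-algebras and o-morphisms is equivalent to the category $\mathbf{cBa}_{\bigvee}$ whose objects are complete Boolean algebras and whose morphisms are the maps preserving arbitrary joins.
   Context: ''Classically'' means in a classical setting (law of excluded middle and powerset axiom available). An overlap algebra (o-algebra) is a triple $(\mathcal P,\le,\bowtie)$ where $(\mathcal P,\le)$ is a suplattice (partial order in which every set-indexed family has a join; $0$ denotes the empty join) and $\bowtie$ is a binary relation on $\mathcal P$ such that for all $p,q$ and all set-indexed families $(q_i)_{i\in I}$: (symmetry) $p\bowtie q\Rightarrow q\bowtie p$; (meet closure) $p\bowtie q\Rightarrow p\bowtie(p\wedge q)$; (splitting of join) $p\bowtie\bigvee_{i\in I}q_i\iff(\exists i\in I)(p\bowtie q_i)$; (density) $(\forall r\in\mathcal P)(r\bowtie p\Rightarrow r\bowtie q)\Rightarrow p\le q$. All o-algebras are assumed set-based: there is a set (or set-indexed family) $S$ of elements, called a base, such that $p=\bigvee\{a\in S\mid a\le p\}$ for all $p$. Binary meets then exist. An o-morphism $f:\mathcal P\to\mathcal Q$ between o-algebras is a map for which there exist maps $f^-,f^*:\mathcal Q\to\mathcal P$ and $f^{-*}:\mathcal P\to\mathcal Q$ such that for all $p\in\mathcal P$, $q\in\mathcal Q$: (1) $f(p)\le q\iff p\le f^*(q)$; (2) $f^-(q)\le p\iff q\le f^{-*}(p)$; (3) $f(p)\bowtie q\iff p\bowtie f^-(q)$. Composition and identities in $\mathbf{OA}$ are those of maps. *)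

(* Defs.v *)
From mathcomp Require Import all_boot all_order.
From mathcomp Require Import boolp classical_sets.

Set Implicit Arguments.
Unset Strict Implicit.
Unset Printing Implicit Defensive.

Import Order.TTheory.
Local Open Scope order_scope.
Local Open Scope classical_set_scope.

#[local] Obligation Tactic := idtac.

Lemma sig_inj (T : Type) (P : T -> Prop) (u v : {x | P x}) :
  sval u = sval v -> u = v.
Proof.
case: u v => [x Px] [y Py] /= xy; case: y / xy Py => Py.
by congr exist; exact: Prop_irrelevance.
Qed.

(** * Categories *)

Record category := Category {
  obj :> Type;
  hom : obj -> obj -> Type;
  idc : forall A, hom A A;
  comp : forall A B C, hom B C -> hom A B -> hom A C;
  comp1c : forall A B (f : hom A B), comp (idc B) f = f;
  compc1 : forall A B (f : hom A B), comp f (idc A) = f;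
  compcA : forall A B C D (h : hom C D) (g : hom B C) (f : hom A B),
    comp h (comp g f) = comp (comp h g) f }.

Record functor (C D : category) := Functor {
  fobj :> C -> D;
  fmap : forall A B : C, hom A B -> hom (fobj A) (fobj B);
  fmap1 : forall A : C, fmap (idc A) = idc (fobj A);
  fmap_comp : forall (A B E : C) (g : hom B E) (f : hom A B),
    fmap (comp g f) = comp (fmap g) (fmap f) }.

Definition id_functor (C : category) : functor C C :=
  @Functor C C id (fun _ _ f => f) (fun _ => erefl) (fun _ _ _ _ _ => erefl).

Program Definition comp_functor (C D E : category)
    (G : functor D E) (F : functor C D) : functor C E :=
  @Functor C E (fun A => G (F A)) (fun _ _ f => fmap G (fmap F f)) _ _.
Next Obligation. by move=> C D E G F A /=; rewrite !fmap1. Qed.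
Next Obligation. by move=> C D E G F A B X g f /=; rewrite !fmap_comp. Qed.

Definition is_iso (C : category) (A B : C) (f : hom A B) : Prop :=
  exists g : hom B A, comp g f = idc A /\ comp f g = idc B.

Definition naturally_isomorphic (C D : category) (F G : functor C D) : Prop :=
  exists eta : forall A : C, hom (F A) (G A),
    (forall (A B : C) (f : hom A B),
       comp (eta B) (fmap F f) = comp (fmap G f) (eta A)) /\
    (forall A : C, is_iso (eta A)).

Definition equivalent_categories (C D : category) : Prop :=
  exists (F : functor C D) (G : functor D C),
    naturally_isomorphic (comp_functor G F) (id_functor C) /\
    naturally_isomorphic (comp_functor F G) (id_functor D).

(** * Overlap algebras *)

Definition is_join (d : Order.disp_t) (T : porderType d) (I : Type)
  (q : I -> T) (p : T) : Prop := supremums (range q) p.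

Definition is_meet2 (d : Order.disp_t) (T : porderType d) (p q m : T) : Prop :=
  infimums [set p; q] m.

(* [oa_base] is the set-basedness requirement: the family [a] is a base and each
   [p] is the join of the base elements below it.
   [overlap_meet] quantifies over every meet of [p] and [q]; it is not vacuous,
   see [o_algebra_meet2] below. *)
Record o_algebra := OAlgebra {
  oa_disp : Order.disp_t;
  oa_sort :> porderType oa_disp;
  overlap : oa_sort -> oa_sort -> Prop;
  oa_join : forall (I : Type) (q : I -> oa_sort), exists p, is_join q p;
  overlap_sym : forall p q, overlap p q -> overlap q p;
  overlap_meet : forall p q m, is_meet2 p q m -> overlap p q -> overlap p m;
  overlap_join : forall p (I : Type) (q : I -> oa_sort) s, is_join q s ->
    (overlap p s <-> exists i, overlap p (q i));
  overlap_dense : forall p q,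
    (forall r, overlap r p -> overlap r q) -> p <= q;
  oa_base : exists (S : Type) (a : S -> oa_sort), forall p,
    supremums [set a i | i in [set i | a i <= p]] p }.

Lemma o_algebra_meet2 (P : o_algebra) (p q : P) : exists m, is_meet2 p q m.
Proof.
pose L := {x : P | lbound [set p; q] x}.
have [m [mub mlub]] := @oa_join P L (fun x => sval x).
exists m; split.
  by move=> y pqy; apply: mlub => _ [x _ <-]; apply: (svalP x).
move=> y yl; apply: mub.
by exists (exist _ y yl).
Qed.

Definition o_morphism (P Q : o_algebra) (f : P -> Q) : Prop :=
  exists (finv fstar : Q -> P) (finvstar : P -> Q),
    [/\ forall p q, f p <= q <-> p <= fstar q,
        forall q p, finv q <= p <-> q <= finvstar p
      & forall p q, overlap (f p) q <-> overlap p (finv q)].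

Lemma o_morphism_id (P : o_algebra) : o_morphism (@id P).
Proof. by exists id, id, id; split. Qed.

Lemma o_morphism_comp (P Q R : o_algebra) (g : Q -> R) (f : P -> Q) :
  o_morphism g -> o_morphism f -> o_morphism (g \o f).
Proof.
move=> [gi [gs [gis [g1 g2 g3]]]] [fi [fs [fis [f1 f2 f3]]]].
exists (fi \o gi), (fs \o gs), (gis \o fis); split=> p q /=.
- exact: (iff_trans (g1 _ _) (f1 _ _)).
- exact: (iff_trans (f2 _ _) (g2 _ _)).
- exact: (iff_trans (g3 _ _) (f3 _ _)).
Qed.

Definition OA_hom (P Q : o_algebra) := {f : P -> Q | o_morphism f}.

Program Definition OA : category :=
  @Category o_algebra OA_hom
    (fun P => exist _ id (o_morphism_id P))
    (fun P Q R g f => exist _ (sval g \o sval f)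
       (o_morphism_comp (svalP g) (svalP f))) _ _ _.
Next Obligation. by move=> P Q f; apply: sig_inj. Qed.
Next Obligation. by move=> P Q f; apply: sig_inj. Qed.
Next Obligation. by move=> P Q R S h g f; apply: sig_inj. Qed.

(** * Complete Boolean algebras and join-preserving maps *)

(* A Boolean algebra is a complemented distributive lattice with bottom and top,
   the one-element algebra included. *)
Record complete_boolean_algebra := CompleteBooleanAlgebra {
  cba_disp : Order.disp_t;
  cba_sort :> ctbDistrLatticeType cba_disp;
  cba_join : forall (I : Type) (q : I -> cba_sort), exists p, is_join q p }.

Definition join_preserving (A B : complete_boolean_algebra) (f : A -> B) : Prop :=
  forall (I : Type) (q : I -> A) (p : A), is_join q p -> is_join (f \o q) (f p).

Lemma join_preserving_id (A : complete_boolean_algebra) :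
  join_preserving (@id A).
Proof. by []. Qed.

Lemma join_preserving_comp (A B C : complete_boolean_algebra)
    (g : B -> C) (f : A -> B) :
  join_preserving g -> join_preserving f -> join_preserving (g \o f).
Proof. by move=> gj fj I q p /fj /gj. Qed.

Definition cBaJoin_hom (A B : complete_boolean_algebra) :=
  {f : A -> B | join_preserving f}.

Program Definition cBaJoin : category :=
  @Category complete_boolean_algebra cBaJoin_hom
    (fun A => exist _ id (@join_preserving_id A))
    (fun A B C g f => exist _ (sval g \o sval f)
       (join_preserving_comp (svalP g) (svalP f))) _ _ _.
Next Obligation. by move=> A B f; apply: sig_inj. Qed.
Next Obligation. by move=> A B f; apply: sig_inj. Qed.
Next Obligation. by move=> A B C D h g f; apply: sig_inj. Qed.

(* Main.v *)
Require Import Defs.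
From HB Require Import structures.
From mathcomp Require Import all_boot all_order.
From mathcomp Require Import boolp classical_sets.

(** In an o-algebra, [x] overlaps itself as soon as something overlaps [x], so
    that, classically, [p] overlaps [q] iff their meet is nonzero, and the join
    of all elements not overlapping [p] is a complement of [p]. Hence o-algebras
    are the complete Boolean algebras, overlap being determined by the order.
    O-morphisms have a right adjoint and so preserve joins; conversely, a
    join-preserving map [f] has a right adjoint [f*], and [~ f* ~] and [~ f ~]
    are the two further maps that make [f] an o-morphism. Both functors thus
    keep carriers, orders and underlying maps. *)

Set Implicit Arguments.
Unset Strict Implicit.
Unset Printing Implicit Defensive.

Import Order.Theory.
Local Open Scope order_scope.

(** * Joins and meets through their universal properties *)

Section JoinMeet.
Variables (d : Order.disp_t) (T : porderType d).

Lemma is_joinP (I : Type) (q : I -> T) (p : T) :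
  is_join q p <-> forall z, p <= z <-> forall i, q i <= z.
Proof.
split=> [[ub lub] z|h].
  split=> [pz i|qz]; first by apply: le_trans pz; apply: ub; exists i.
  by apply: lub => _ [i _ <-].
split; first by move=> _ [i _ <-]; apply/h: i.
by move=> z zub; apply/h => i; apply: zub; exists i.
Qed.

Lemma is_meet2P (p q m : T) :
  is_meet2 p q m <-> forall z, z <= m <-> z <= p /\ z <= q.
Proof.
split=> [[lb glb] z|h].
  split=> [zm|[zp zq]]; last by apply: glb => _ [->|->].
  by split; apply: le_trans zm _; apply: lb; [left|right].
have [mp mq] : m <= p /\ m <= q by apply/h.
split; first by move=> _ [->|->].
by move=> z zlb; apply/h; split; apply: zlb; [left|right].
Qed.

(** Turns an inequality into a join, so that whatever respects joins is seen to be monotone. *)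
Lemma is_join_if (p q : T) :
  p <= q -> is_join (fun b : bool => if b then p else q) q.
Proof.
move=> pq; apply/is_joinP => z; split=> [qz []|/(_ false)//] //.
exact: le_trans pq qz.
Qed.

End JoinMeet.

(** * Boolean structure of an o-algebra *)

Section OAlgebraBoolean.
Variable P : o_algebra.
Implicit Types p q r : P.

Definition oa_lub (I : Type) (q : I -> P) : P := sval (cid (oa_join q)).

Lemma oa_lub_join (I : Type) (q : I -> P) : is_join q (oa_lub q).
Proof. exact: svalP (cid _). Qed.

Lemma oa_lub_le (I : Type) (q : I -> P) z :
  oa_lub q <= z <-> forall i, q i <= z.
Proof. by move: z; apply/is_joinP; exact: oa_lub_join. Qed.

Lemma oa_lub_ub (I : Type) (q : I -> P) i : q i <= oa_lub q.
Proof. by move: i; apply/oa_lub_le. Qed.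

Lemma overlap_lub p (I : Type) (q : I -> P) :
  overlap p (oa_lub q) <-> exists i, overlap p (q i).
Proof. exact: overlap_join (oa_lub_join q). Qed.

Lemma overlap_le p q r : q <= r -> overlap p q -> overlap p r.
Proof. by move=> qr pq; apply/(overlap_join _ (is_join_if qr)); exists true. Qed.

(** Meet closure is used twice: it makes the meet [m] overlap [p], and then, [m] being also the meet
    of [m] and [p], it makes [m] overlap itself. *)
Lemma overlap_self p q : overlap p q ->
  exists m, [/\ m <= p, m <= q & overlap m m].
Proof.
have [m /[dup] mM /is_meet2P mP] := o_algebra_meet2 p q.
move=> /(overlap_meet mM)/overlap_sym mp.
have [mlep mleq] : m <= p /\ m <= q by apply/mP.
exists m; split=> //; apply: overlap_meet mp.
by apply/is_meet2P => z; split=> [zm|[]//]; split=> //; apply: le_trans zm mlep.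
Qed.

Lemma self_overlap m p q : m <= p -> m <= q -> overlap m m -> overlap p q.
Proof. by move=> mp mq /(overlap_le mp)/overlap_sym/(overlap_le mq). Qed.

Definition oa_meet p q : P := sval (cid (o_algebra_meet2 p q)).
Definition oa_cup p q : P := oa_lub (fun b : bool => if b then p else q).
Definition oa_bot : P := oa_lub (of_void P).
Definition oa_top : P := oa_lub (@id P).
Definition oa_compl p : P := oa_lub (fun x : {x : P | ~ overlap x p} => sval x).

Lemma oa_meetP r p q : (r <= oa_meet p q) = (r <= p) && (r <= q).
Proof.
have /is_meet2P h : is_meet2 p q (oa_meet p q) := svalP (cid _).
by apply/idP/andP => /h.
Qed.

Lemma oa_cupP p q r : (oa_cup p q <= r) = (p <= r) && (q <= r).
Proof.
apply/idP/andP => [/oa_lub_le h|[pr qr]]; last by apply/oa_lub_le => -[].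
by split; [exact: (h true)|exact: (h false)].
Qed.

Lemma oa_bot_le p : oa_bot <= p.
Proof. by apply/oa_lub_le => -[]. Qed.

Lemma le_oa_top p : p <= oa_top.
Proof. exact: (@oa_lub_ub P id). Qed.

Lemma overlap_bot p : ~ overlap p oa_bot.
Proof. by move=> /overlap_lub[[]]. Qed.

Lemma overlap_cup r p q : overlap r (oa_cup p q) <-> overlap r p \/ overlap r q.
Proof.
split=> [/overlap_lub[[] ?]|rpq]; [by left|by right|].
by apply/overlap_lub; case: rpq => ?; [exists true|exists false].
Qed.

Lemma overlapE p q : overlap p q <-> oa_meet p q <> oa_bot.
Proof.
have /andP[mp mq] : (oa_meet p q <= p) && (oa_meet p q <= q).
  by rewrite -oa_meetP.
split=> [/overlap_self[m [lmp lmq mm]] pq0|pq0].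
  apply: (@overlap_bot m); rewrite -pq0; apply: overlap_le mm.
  by rewrite oa_meetP lmp.
(* If [p] and [q] do not overlap, nothing overlaps their meet, which is then below [oa_bot] by
   density. *)
apply: contrapT => npq; apply/pq0/le_anti; rewrite oa_bot_le andbT.
apply: overlap_dense => r /overlap_self[m [_ lm mm]].
by case: npq; apply: self_overlap mm; [apply: le_trans mp|apply: le_trans mq].
Qed.

Lemma not_overlap_compl p : ~ overlap p (oa_compl p).
Proof. by move=> /overlap_lub[[x nx] /= /overlap_sym]. Qed.

Lemma oa_cup_compl p : oa_cup p (oa_compl p) = oa_top.
Proof.
apply/le_anti; rewrite le_oa_top /=; apply: overlap_dense => r rT.
(* Excluded middle: an [r] that does not overlap [p] is one of the elements joined in
   [oa_compl p]. *)
apply/overlap_cup; have [rp|nrp] := pselect (overlap r p); first by left.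
have rC : r <= oa_compl p.
  exact: (oa_lub_ub _ (exist _ r nrp : {x : P | ~ overlap x p})).
right; have [m [mr _ mm]] := overlap_self rT.
by apply: self_overlap mm => //; apply: le_trans rC.
Qed.

Lemma oa_meet_compl p : oa_meet p (oa_compl p) = oa_bot.
Proof. by apply: contrapT => /overlapE; exact: not_overlap_compl. Qed.

(** By density: a self-overlapping element below the left side overlaps [p] or [q], and shrinking it
    once more puts it below one of the two meets. *)
Lemma oa_meet_cup_le p q r :
  oa_meet (oa_cup p q) r <= oa_cup (oa_meet p r) (oa_meet q r).
Proof.
apply: overlap_dense => s /overlap_self[m [ms]].
rewrite oa_meetP => /andP[mpq mr] /(overlap_le mpq)/overlap_cup mpVq.
apply/overlap_cup; case: mpVq => /overlap_self[n [nm np nn]]; [left|right].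
all: apply: self_overlap nn; first exact: le_trans ms.
all: by rewrite oa_meetP np; apply: le_trans mr.
Qed.

(** An alias of the carrier to which the lattice instances are attached, over the unchanged order of
    [P]. *)
Definition oa_boolean : Type := P.

HB.instance Definition _ := Order.POrder.copy oa_boolean P.

HB.instance Definition _ :=
  Order.POrder_MeetJoin_isLattice.Build _ oa_boolean oa_meetP oa_cupP.

Lemma oa_meetUl : @left_distributive oa_boolean oa_boolean Order.meet Order.join.
Proof.
move=> p q r; apply/le_anti; apply/andP; split; first exact: oa_meet_cup_le.
by rewrite leUx !leI2 ?leUl ?leUr.
Qed.

HB.instance Definition _ :=
  Order.Lattice_Meet_isDistrLattice.Build _ oa_boolean oa_meetUl.
HB.instance Definition _ := Order.hasBottom.Build _ oa_boolean oa_bot_le.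
HB.instance Definition _ := Order.hasTop.Build _ oa_boolean le_oa_top.
HB.instance Definition _ :=
  Order.TBDistrLattice_hasComplement.Build _ oa_boolean
    oa_cup_compl oa_meet_compl.

Definition cba_of_oa : complete_boolean_algebra :=
  @CompleteBooleanAlgebra _ oa_boolean (@oa_join P).

End OAlgebraBoolean.

(** * Overlap on a complete Boolean algebra *)

Section BooleanOAlgebra.
Variable A : complete_boolean_algebra.
Implicit Types p q r : A.

Definition cba_overlap p q : Prop := p `&` q <> \bot.

(** Turns the splitting of joins and density into statements about the order. *)
Lemma not_cba_overlap p q : ~ cba_overlap p q <-> p <= ~` q.
Proof.
rewrite -disj_leC; by split=> [/contrapT/eqP|/eqP pq /(_ pq)].
Qed.

Lemma cba_overlap_sym p q : cba_overlap p q -> cba_overlap q p.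
Proof. by rewrite /cba_overlap meetC. Qed.

Lemma cba_overlap_meet p q m :
  is_meet2 p q m -> cba_overlap p q -> cba_overlap p m.
Proof.
move=> /is_meet2P h; suff -> : m = p `&` q by rewrite /cba_overlap meetA meetxx.
apply/le_anti; rewrite lexI; apply/andP; split; first by apply/andP/h.
by apply/h; split; [exact: leIl|exact: leIr].
Qed.

Lemma cba_overlap_join p (I : Type) (q : I -> A) s : is_join q s ->
  (cba_overlap p s <-> exists i, cba_overlap p (q i)).
Proof.
move=> /is_joinP h; split=> [ps|[i pqi]]; apply: contrapT.
  move=> /forallNP npq; have : ~ cba_overlap p s; last exact.
  apply/not_cba_overlap; rewrite lexC; apply/h => i.
  by rewrite lexC; apply/not_cba_overlap.
move=> /not_cba_overlap; rewrite lexC => /h /(_ i); rewrite lexC.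
by move=> /not_cba_overlap.
Qed.

Lemma cba_overlap_dense p q :
  (forall r, cba_overlap r p -> cba_overlap r q) -> p <= q.
Proof.
(* The hypothesis is tested at the complement of [q], which cannot overlap [q]. *)
move=> h; rewrite -[q]complK; apply/not_cba_overlap => /cba_overlap_sym/h.
by rewrite /cba_overlap meetC meetxC.
Qed.

Lemma cba_base : exists (S : Type) (a : S -> A), forall p,
  supremums [set a i | i in [set i | a i <= p]]%classic p.
Proof.
exists A, id => p; split; first by move=> _ [x xp <-].
by move=> z; apply; exists p => //=.
Qed.

Definition oa_of_cba : o_algebra :=
  OAlgebra (@cba_join A) cba_overlap_sym cba_overlap_meet cba_overlap_join
    cba_overlap_dense cba_base.

End BooleanOAlgebra.

(** * O-morphisms and join-preserving maps *)

Lemma o_morphism_join_preserving (P Q : o_algebra) (f : P -> Q) :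
  o_morphism f ->
  @join_preserving (cba_of_oa P) (cba_of_oa Q) f.
Proof.
move=> [fi [fs [fis [adj _ _]]]] I q p /is_joinP h; apply/is_joinP => z.
split=> [/adj/h qz i|qz]; first exact/adj.
by apply/adj/h => i; apply/adj; exact: qz.
Qed.

Lemma join_preserving_le (A B : complete_boolean_algebra) (f : A -> B) p q :
  join_preserving f -> p <= q -> f p <= f q.
Proof.
by move=> fj /is_join_if/fj/is_joinP/(_ (f q))[/(_ (lexx _))/(_ true)].
Qed.

Lemma join_preserving_adjoint (A B : complete_boolean_algebra) (f : A -> B) :
  join_preserving f -> exists g : B -> A, forall p q, f p <= q <-> p <= g q.
Proof.
(* The adjoint at [q] is the join of all [p] with [f p <= q]; as [f] preserves this join, its image
   is still below [q]. *)
move=> fj; pose g q := sval (cid (@cba_join A {p | f p <= q} sval)).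
have gJ q : is_join sval (g q) := svalP (cid _).
exists g => p q; split=> [fpq|pgq].
  exact: (((is_joinP _ _).1 (gJ q) _).1 (lexx _) (exist _ p fpq)).
apply: le_trans (join_preserving_le fj pgq) _.
by apply/((is_joinP _ _).1 (fj _ _ _ (gJ q))) => -[].
Qed.

Lemma join_preserving_o_morphism (A B : complete_boolean_algebra) (f : A -> B) :
  join_preserving f -> @o_morphism (oa_of_cba A) (oa_of_cba B) f.
Proof.
move=> fj; have [g adj] := join_preserving_adjoint fj.
exists (fun q => ~` (g (~` q))), g, (fun p => ~` (f (~` p))); split=> //.
  by move=> q p; rewrite [_ <= _]leCx [q <= _]lexC; split=> /adj.
(* Negated, the overlap condition is the adjunction at the complement of [q]. *)
move=> p q; have h : ~ cba_overlap (f p) q <-> ~ cba_overlap p (~` g (~` q)).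
  by rewrite !not_cba_overlap complK; exact: adj.
by split=> /= ov; apply: contrapT => /h.
Qed.

(** Kept transparent, so that both round trips compute to the original carrier and identity maps can
    serve as the natural isomorphisms. *)
Definition OA_to_cBaJoin : functor OA cBaJoin.
Proof.
exists cba_of_oa (fun P Q f =>
  exist _ (sval f) (o_morphism_join_preserving (svalP f)))=> *; exact: sig_inj.
Defined.

Definition cBaJoin_to_OA : functor cBaJoin OA.
Proof.
exists oa_of_cba (fun A B f =>
  exist _ (sval f) (join_preserving_o_morphism (svalP f)))=> *; exact: sig_inj.
Defined.

Theorem corollary3p19 : equivalent_categories OA cBaJoin.
Proof.
exists OA_to_cBaJoin, cBaJoin_to_OA; split.
  (* This round trip replaces the overlap of [P] by nonzero meet, an equivalent relation. *)
  have ovE (P : o_algebra) (p q : P) :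
      @overlap (oa_of_cba (cba_of_oa P)) p q <-> overlap p q.
    exact: iff_sym (overlapE p q).
  have unit_o (P : o_algebra) : @o_morphism (oa_of_cba (cba_of_oa P)) P id.
    by exists id, id, id; split=> // p q; exact: iff_sym (ovE P p q).
  have counit_o (P : o_algebra) : @o_morphism P (oa_of_cba (cba_of_oa P)) id.
    by exists id, id, id; split=> // p q; exact: ovE.
  exists (fun P => exist _ id (unit_o P)); split=> [P Q f|P].
    exact: sig_inj.
  by exists (exist _ id (counit_o P)); split; exact: sig_inj.
(* Preservation of joins depends on the order alone, which this round trip leaves unchanged. *)
have to_j (A : complete_boolean_algebra) :
  @join_preserving (cba_of_oa (oa_of_cba A)) A id by [].
have of_j (A : complete_boolean_algebra) :
  @join_preserving A (cba_of_oa (oa_of_cba A)) id by [].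
exists (fun A => exist _ id (to_j A)); split=> [A B f|A]; first exact: sig_inj.
by exists (exist _ id (of_j A)); split; exact: sig_inj.
Qed.
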